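(* Every regular normal extremal that is time-optimal for the problem below has at most two switching times, i.e. consists of at most three arcs. Moreover its bang pattern (ordered sequence of arc types) is either $X$ or $X\,Y\,X$; in particular, the only pattern with at least one switching is $XYX$ (global–local–global).
   Context: Fix $\gamma\in(0,\pi/2)$, $s=\sin\gamma$, $c=\cos\gamma$, and $X=\begin{pmatrix}0&s^2&sc\\-s^2&0&0\\-sc&0&0\end{pmatrix}$ (continuous-limit generator of the global Grover operator), $Y=\begin{pmatrix}0&1&0\\-1&0&0\\0&0&0\end{pmatrix}$ (generator of the local Grover operator), acting on $\mathbb R^3$ with standard basis $e_1,e_2,e_3$ and standard inner product. Let $\Sigma=\{\psi:\langle e_3,\psi\rangle=0\}$, $\psi_0=(0,s,c)^\top$. Time-optimal problem: over piecewise constant controls $A:[0,T]\to\{X,Y\}$ with finitely many discontinuities (switching times) and trajectories $\dot\psi=A(t)\psi$, $\psi(0)=\psi_0$, minimize $T$ subject to $\psi(T)\in\Sigma$. Maximal intervals on which $A\equiv X$ (resp. $Y$) are $X$-arcs (resp. $Y$-arcs). A normal extremal is such a trajectory with a nonzero absolutely continuous costate $p$ satisfying $\dot p=-A(t)^\top p$ and, for a.e. $t$, $\langle p,A(t)\psi\rangle-1=\max_{B\in\{X,Y\}}(\langle p,B\psi\rangle-1)$. Let $F_1=X-Y$, $F_2=[X,Y]$, $\phi_1=\langle p,F_1\psi\rangle$ (the switching function), $\phi_2=\langle p,F_2\psi\rangle$. A normal extremal is regular (bang–bang) if $\phi_1$ vanishes only at isolated times and at every switching time $\phi_1=0$ and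 $\phi_2\neq0$. *)

(* Defs.v *)
From HB Require Import structures.
From mathcomp Require Import all_boot all_order all_algebra.
From mathcomp Require Import all_classical all_reals all_analysis.
Set Implicit Arguments. Unset Strict Implicit. Unset Printing Implicit Defensive.
Import Order.TTheory GRing.Theory Num.Theory.
Import numFieldNormedType.Exports.
Local Open Scope ring_scope.

Section Grover.
Variable R : realType.

Definition ip (u v : 'cV[R]_3) : R := \sum_(i < 3) u i 0 * v i 0.

Definition e3 : 'cV[R]_3 := \col_(i < 3) (i == 2%N :> nat)%:R.

Definition Xmat (g : R) : 'M[R]_3 :=
  \matrix_(i < 3, j < 3)
    match nat_of_ord i, nat_of_ord j with
    | 0%N, 1%N => sin g ^+ 2
    | 0%N, 2%N => sin g * cos g
    | 1%N, 0%N => - sin g ^+ 2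
    | 2%N, 0%N => - (sin g * cos g)
    | _, _ => 0
    end.

Definition Ymat : 'M[R]_3 :=
  \matrix_(i < 3, j < 3)
    match nat_of_ord i, nat_of_ord j with
    | 0%N, 1%N => 1
    | 1%N, 0%N => -1
    | _, _ => 0
    end.

Definition psi0 (g : R) : 'cV[R]_3 := \col_(i < 3)
    match nat_of_ord i with 0%N => 0 | 1%N => sin g | _ => cos g end.

Definition inSigma (v : 'cV[R]_3) : Prop := ip e3 v = 0.

Definition F1 (g : R) : 'M[R]_3 := Xmat g - Ymat.
Definition F2 (g : R) : 'M[R]_3 := Xmat g *m Ymat - Ymat *m Xmat g.

Definition abs_cont_on (a b : R) (f : R -> R) : Prop :=
  forall e : R, 0 < e -> exists2 d : R, 0 < d &
    forall (n : nat) (l r : 'I_n -> R),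
      (forall i, [/\ a <= l i, l i <= r i & r i <= b]) ->
      (forall i j, i != j -> r i <= l j \/ r j <= l i) ->
      \sum_(i < n) (r i - l i) < d ->
      \sum_(i < n) `|f (r i) - f (l i)| < e.

Definition solves (T : R) (M : R -> 'M[R]_3) (x : R -> 'cV[R]_3) : Prop :=
  (forall i : 'I_3, abs_cont_on 0 T (fun t => x t i 0)) /\
  {ae (@lebesgue_measure R), forall t, t \in `[0, T] ->
     forall i : 'I_3, derivable (fun u => x u i 0) t 1 /\
       derive1 (fun u => x u i 0) t = (M t *m x t) i 0}.

(* A piecewise constant control with values in {X, Y} on [0,T] with finitely
   many discontinuities is given by times 0 < t_1 < ... < t_k < T and labels
   b_0, ..., b_k (true = X, false = Y); on (t_i, t_{i+1}) the control is b_i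
   (with t_0 = 0, t_{k+1} = T).  Values at the finitely many times t_i are
   irrelevant (measure zero). *)
Definition admissible (T : R) (ts : seq R) (bs : seq bool) : Prop :=
  [/\ 0 <= T, size bs = (size ts).+1, path <%R 0 ts & all (fun s => s < T) ts].

Definition label (ts : seq R) (bs : seq bool) (t : R) : bool :=
  nth false bs (count (fun s => s < t) ts).

Definition ctrl (g : R) (ts : seq R) (bs : seq bool) (t : R) : 'M[R]_3 :=
  if label ts bs t then Xmat g else Ymat.

(* the t_i are exactly the switching times and the b_i the types of the
   maximal arcs: consecutive labels differ *)
Definition alternating (bs : seq bool) : Prop :=
  forall i : nat, (i.+1 < size bs)%N -> nth false bs i != nth false bs i.+1.

Definition trajectory (g T : R) ts bs (psi : R -> 'cV[R]_3) : Prop :=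
  admissible T ts bs /\ solves T (ctrl g ts bs) psi /\ psi 0 = psi0 g.

Definition time_optimal (g T : R) : Prop :=
  forall (T' : R) ts' bs' (psi' : R -> 'cV[R]_3),
    trajectory g T' ts' bs' psi' -> inSigma (psi' T') -> T <= T'.

Definition normal_extremal (g T : R) ts bs (psi p : R -> 'cV[R]_3) : Prop :=
  [/\ trajectory g T ts bs psi /\ alternating bs, inSigma (psi T),
      solves T (fun t => - (ctrl g ts bs t)^T) p,
      ~ (forall t, t \in `[0, T] -> p t = 0) &
      {ae (@lebesgue_measure R), forall t, t \in `[0, T] ->
         ip (p t) (ctrl g ts bs t *m psi t) - 1 =
         Num.max (ip (p t) (Xmat g *m psi t) - 1)
                 (ip (p t) (Ymat *m psi t) - 1)}].

Definition phi1 (g : R) (psi p : R -> 'cV[R]_3) (t : R) : R :=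
  ip (p t) (F1 g *m psi t).
Definition phi2 (g : R) (psi p : R -> 'cV[R]_3) (t : R) : R :=
  ip (p t) (F2 g *m psi t).

Definition regular (g T : R) (ts : seq R) (psi p : R -> 'cV[R]_3) : Prop :=
  (forall t, t \in `[0, T] -> phi1 g psi p t = 0 ->
     exists2 e : R, 0 < e & forall u, u \in `[0, T] -> 0 < `|u - t| < e ->
       phi1 g psi p u != 0) /\
  (forall s, s \in ts -> phi1 g psi p s = 0 /\ phi2 g psi p s != 0).

End Grover.

(* Main.v *)
Require Import Defs.
From HB Require Import structures.
From mathcomp Require Import all_boot all_order all_algebra.
From mathcomp Require Import all_classical all_reals all_analysis.
From mathcomp Require Import measurable_realfun ring lra.
Import Order.TTheory GRing.Theory Num.Theory.
Import numFieldNormedType.Exports.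
Local Open Scope ring_scope.
Local Open Scope classical_set_scope.

(** Let [s = sin g], [c = cos g], [u = (0, s, c) = psi0] and [n = (0, c, -s)].
    The generator X rotates the plane [(e1, u)] with speed [s] and fixes [n],
    and [X - Y = c (n e1^T - e1 n^T)].  Hence [phi1] vanishes at time 0, and
    along an X-arc it is a sinusoid of frequency [s]: an X-arc starting and
    ending at zeros of [phi1], on which [phi1] is not identically zero, lasts at
    least [pi / s].  But the pure X trajectory reaches Sigma at time
    [pi / (2 s)].  So a first X-arc followed by a switching, and an X-arc between
    two switchings, are both impossible; this leaves X, Y and YX.  Y conserves
    the height [e3], and under YX the height is still positive at time
    [pi / (2 s)].  The costate and state equations hold only almost everywhere;
    they are integrated using that an absolutely continuous function with a.e.
    zero derivative is constant. *)

(** * Gauge arguments and vanishing derivatives almost everywhere *)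

(** Cousin's compactness argument: the gauge at the supremum of the points where [P] holds carries
    [P] strictly beyond it, unless [b] is already within reach. *)
Lemma gauge_induction (R : realType) (P : R -> Prop) (a b : R) :
  a <= b -> P a ->
  (forall t, a <= t <= b -> exists2 d : R, 0 < d &
     forall u v, a <= u <= t -> t <= v <= b -> t - d < u -> v < t + d ->
       P u -> P v) ->
  P b.
Proof.
move=> ab Pa step.
pose S := [set t | a <= t <= b /\ P t].
have Sa : S a by split => //; rewrite lexx ab.
have supS : has_sup S by split; [exists a | exists b => t [/andP[]]].
have ac : a <= sup S by apply: ub_le_sup Sa; case: supS.
have cb : sup S <= b by apply: ge_sup; [exists a | move=> t [/andP[]]].
have [|d d0 stepc] := step (sup S); first by rewrite ac.
have [u [/andP[au ub] Pu] cu] := sup_adherent d0 supS.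
have uc : u <= sup S by apply: ub_le_sup => //; [case: supS | split => //; rewrite au].
have [bd|db] := ltP b (sup S + d).
  by apply: (stepc u b) => //; rewrite ?au ?cb ?lexx.
have : S (sup S + d / 2).
  split; first by apply/andP; split; lra.
  by apply: (stepc u) => //; [rewrite au|apply/andP; split; lra|lra].
by move=> /(ub_le_sup (proj2 supS)); lra.
Qed.

(** Splitting the increment at [t] bounds each half separately; requiring [u <= t <= v] makes the
    two lengths add up to [v - u]. *)
Lemma derive0_gauge (R : realType) (f : R -> R) (t e : R) :
  is_derive t 1 f 0 -> 0 < e -> exists2 d : R, 0 < d &
    forall u v, u <= t <= v -> t - d < u -> v < t + d ->
      `|f v - f u| <= e * (v - u).
Proof.
move=> [/cvg_ex[l df] fl] e0.
have l0 : l = 0.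
  by rewrite -fl /derive; apply/esym/cvg_lim.
rewrite {}l0 in df.
have /cvgrPdist_le/(_ _ e0) := df.
move=> /nbhs_ballP[d /= d0 H].
have key h : `|h| < d -> `|f (t + h) - f t| <= e * `|h|.
  have [->|h0] := eqVneq h 0; first by rewrite addr0 subrr !normr0 mulr0.
  move=> hd; have /(_ _ h0) := H h; rewrite /ball/= sub0r normrN => /(_ hd).
  rewrite sub0r normrN scaler1 normrZ normfV ler_pdivrMl ?normr_gt0//.
  by rewrite mulrC (addrC h).
exists d => // u v /andP[ut tv] du vd.
have -> : f v - f u = (f (t + (v - t)) - f t) - (f (t + (u - t)) - f t).
  by rewrite !subrKC; ring.
rewrite (le_trans (ler_normB _ _))//.
have := key (v - t); have := key (u - t).
rewrite (ler0_norm (_ : u - t <= 0)) ?subr_le0// (ger0_norm (_ : 0 <= v - t)) ?subr_ge0//.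
move=> /(_ ltac:(lra)) h1 /(_ ltac:(lra)) h2; lra.
Qed.

Section ac_cst.
Variable R : realType.
Local Notation mu := (@lebesgue_measure R).

(** Outer regularity is applied to a measurable null set containing [N], as [N] itself may fail to
    be measurable. *)
Lemma negligible_open_cover (N : set R) (e : R) :
  mu.-negligible N -> 0 < e ->
  exists U : set R, [/\ open U, N `<=` U & (mu U < e%:E)%E].
Proof.
move=> [A [mA A0 NA]] e0.
have Afin : (mu A < +oo)%E by rewrite A0 ltry.
have [U [oU AU mUA]] := @lebesgue_regularity_outer R A e mA Afin e0.
exists U; split => //; first exact: subset_trans AU.
apply: le_lt_trans mUA.
rewrite -[X in (mu X <= _)%E](setDUK AU).
have mD : measurable (U `\` A) by apply: measurableD => //; exact: open_measurable.
apply: (le_trans (measureU2 mu mA mD)).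
by rewrite [X in (X + _)%E](_ : _ = 0%E) ?add0e.
Qed.

(* The gauge at [t] is chosen so that [f] has slope at most [e'] there, or, on
   the exceptional null set, so that the interval stays in a cover of measure
   less than [d]; absolute continuity bounds the contribution of the latter. *)
Lemma ac_derive0_cst (a b : R) (f : R -> R) : a <= b ->
  abs_cont_on a b f ->
  {ae mu, forall t, t \in `]a, b[%R -> is_derive t 1 f 0} ->
  f b = f a.
Proof.
move=> ab acf df.
apply/eqP; rewrite -subr_eq0 -normr_le0; apply/ler_addgt0Pr => e e0; rewrite add0r.
(* Chosen so that [e' * (b - a) + e' = e]: one term for the slopes, one for the exceptional
   intervals. *)
pose e' := e / (1 + (b - a)).
have e'0 : 0 < e' by rewrite divr_gt0//; lra.
have [d d0 acd] := acf _ e'0.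
(* The endpoints join the null set because the derivative is only known on the open interval. *)
pose N := [set t | ~ (t \in `]a, b[%R -> is_derive t 1 f 0)] `|` ([set a] `|` [set b]).
have : mu.-negligible N.
  have neg1 x : mu.-negligible [set x].
    by exists [set x]; split => //; exact: lebesgue_measure_set1.
  by apply: negligibleU => //; exact: negligibleU.
move=> /(negligible_open_cover _ d)/(_ d0)[U [oU NU mUd]].
have mU : measurable U by exact: open_measurable.
(* The list [s] holds the disjoint intervals gathered so far around points of [U], newest first;
   their total length is controlled by the part of [U] already swept. *)
pose P t := a <= t <= b /\ exists s : seq (R * R),
  [/\ pairwise (fun q1 q2 => q2.2 <= q1.1) s,
      all (fun q => [&& a <= q.1, q.1 <= q.2 & q.2 <= t]) s,
      ((\sum_(q <- s) (q.2 - q.1))%:E <= mu (U `&` `[a, t]))%E &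
      `|f t - f a| <= e' * (t - a) + \sum_(q <- s) `|f q.2 - f q.1|].
have : P b.
  apply: (@gauge_induction R P a b ab).
    split; first by rewrite lexx.
    exists [::]; split => //; rewrite !big_nil//.
    by rewrite !subrr normr0 mulr0 addr0.
  move=> t /andP[at_ tb].
  have [Ut|nUt] := pselect (U t).
    have /nbhs_ballP[r /= r0 rU] := open_nbhs_nbhs (conj oU Ut).
    exists r => // u v /andP[au ut] /andP[tv vb] ru vr [_ [s [ps als lens fs]]].
    split; first by apply/andP; split; lra.
    exists ((u, v) :: s); split.
    - rewrite /= ps andbT; apply/allP => q /(allP als) /and3P[_ _ ] //.
    - rewrite /= lexx au (le_trans ut tv)/=.
      apply/allP => q /(allP als) /and3P[-> -> /=]; lra.
    - rewrite big_cons /= EFinD addeC.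
      have -> : U `&` `[a, v] = (U `&` `[a, u]) `|` `]u, v].
        apply/seteqP; split => x /=; rewrite !in_itv/=.
          move=> [Ux /andP[ax xv]]; have [xu|ux] := leP x u.
            by left; rewrite ax.
          by right; rewrite ?ux ?xv.
        case=> [[Ux /andP[ax xu]]|/andP[ux xv]].
          by split => //; rewrite ax/=; lra.
        split; last by apply/andP; split; lra.
        by apply: rU; rewrite /ball/= ltr_distlC; apply/andP; split; lra.
      rewrite measureU//=.
      + rewrite leeD// lebesgue_measure_itv/= lte_fin; case: ltP => // vu.
        by rewrite lee_fin; lra.
      + by apply: measurableI.
      + apply/seteqP; split => // x [] /= [_]; rewrite !in_itv/=.
        by move=> /andP[_ xu] /andP[ux _]; lra.
    - rewrite big_cons/=.
      have -> : f v - f a = (f u - f a) + (f v - f u) by ring.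
      rewrite (le_trans (ler_normD _ _))//.
      have : 0 <= e' * (v - u) by rewrite mulr_ge0//; lra.
      lra.
  have nN : ~ N t by move=> /NU.
  have abt : t \in `]a, b[%R.
    rewrite in_itv/= !lt_neqAle at_ tb !andbT.
    apply/andP; split; apply/negP => /eqP E; apply: nN; right.
      by left => /=.
    by right => /=.
  have dft : is_derive t 1 f 0.
    by apply: contrapT => nd; apply: nN; left => /= /(_ abt).
  have [r r0 H] := derive0_gauge _ _ _ _ dft e'0.
  exists r => // u v /andP[au ut] /andP[tv vb] ru vr [_ [s [ps als lens fs]]].
  split; first by apply/andP; split; lra.
  exists s; split => //.
  - apply/allP => q /(allP als) /and3P[-> -> /=]; lra.
  - rewrite (le_trans lens)// le_measure ?inE//.
    + exact: measurableI.
    + exact: measurableI.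
    + move=> x /= [Ux]; rewrite !in_itv/= => /andP[ax xu].
      by split => //; apply/andP; split; lra.
  - have -> : f v - f a = (f u - f a) + (f v - f u) by ring.
    rewrite (le_trans (ler_normD _ _))//.
    have := H u v; rewrite ut tv => /(_ isT ru vr); lra.
move=> [_ [s [ps als lens fs]]].
pose q0 : R * R := (a, a).
have Hs : \sum_(q <- s) `|f q.2 - f q.1| < e'.
  rewrite (big_nth q0) big_mkord.
  apply: (acd _ (fun i => (nth q0 s i).1) (fun i => (nth q0 s i).2)).
  - by move=> i; have /and3P[] := allP als _ (mem_nth q0 (ltn_ord i)).
  - have H (i j : 'I_(size s)) : (i < j)%N -> (nth q0 s j).2 <= (nth q0 s i).1.
      by move=> ij; move/pairwiseP: ps => /(_ q0 i j); apply => //; rewrite inE.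
    move=> i j; rewrite neq_ltn => /orP[] /H; by [right|left].
  - have := le_lt_trans lens _; move=> /(_ d%:E).
    rewrite lte_fin (big_nth q0) big_mkord; apply; apply: le_lt_trans mUd.
    by rewrite le_measure ?inE//; exact: measurableI.
apply: (le_trans fs).
have -> : e = e' * (b - a) + e'.
  rewrite /e' -{2}[e / _]mulr1 -mulrDr addrC [b - a + 1]addrC mulrVK// unitfE; lra.
lra.
Qed.
End ac_cst.

(** * Calculus of absolutely continuous functions and planar rotations *)

Section ac_algebra.
Variable R : realType.
Implicit Types (a b : R) (f g : R -> R).

Lemma abs_cont_onS a b a' b' f : a <= a' -> b' <= b ->
  abs_cont_on a b f -> abs_cont_on a' b' f.
Proof.
move=> aa bb acf e /acf[d d0 H]; exists d => // n l r lr; apply: H => i.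
by have [? ? ?] := lr i; split => //; [exact: le_trans aa _|exact: le_trans bb].
Qed.

(** Over any interval shorter than the [d] given for tolerance 1, [f] varies by less than 1, so each
    gauge step raises the bound by at most 1. *)
Lemma abs_cont_on_bounded a b f : abs_cont_on a b f ->
  exists2 M : R, 0 <= M & forall t, a <= t <= b -> `|f t| <= M.
Proof.
move=> acf; have [ba|ab] := ltP b a.
  by exists 0 => // t /andP[at_ tb]; lra.
have [d d0 acd] := acf _ (@ltr01 R).
pose P t := a <= t <= b /\ exists2 M : R, 0 <= M & forall x, a <= x <= t -> `|f x| <= M.
suff [] : P b by [].
apply: (@gauge_induction R P a b ab).
  split; first by rewrite lexx.
  by exists `|f a| => // x; rewrite -eq_le => /eqP <-.
move=> t _; exists (d / 2); first by lra.
move=> u v /andP[au ut] /andP[tv vb] du vd [_ [M M0 HM]].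
split; first by apply/andP; split; lra.
exists (M + 1) => [|x /andP[ax xv]]; first by lra.
have [xu|ux] := leP x u; first by have := HM x; rewrite ax xu => /(_ isT); lra.
have fxu : `|f x - f u| < 1.
  have := acd 1%N (fun=> u) (fun=> x); rewrite !big_ord1; apply.
  - by move=> _; split; lra.
  - by move=> i j; rewrite !ord1 eqxx.
  - by lra.
have fu : `|f u| <= M by apply: HM; rewrite au lexx.
have := ler_normD (f x - f u) (f u); rewrite subrK; lra.
Qed.

Lemma abs_cont_onD a b f g : abs_cont_on a b f -> abs_cont_on a b g ->
  abs_cont_on a b (fun t => f t + g t).
Proof.
move=> acf acg e e0; have e20 : 0 < e / 2 by lra.
have [d1 d10 H1] := acf _ e20; have [d2 d20 H2] := acg _ e20.
exists (Num.min d1 d2); first by rewrite lt_min d10.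
move=> n l r lr dis; rewrite lt_min => /andP[s1 s2].
have h1 := H1 n l r lr dis s1; have h2 := H2 n l r lr dis s2.
rewrite [ltRHS](_ : _ = e / 2 + e / 2); last by lra.
apply: le_lt_trans (ltrD h1 h2); rewrite -big_split/= ler_sum// => i _.
rewrite [X in `|X|](_ : _ = (f (r i) - f (l i)) + (g (r i) - g (l i))); last by ring.
exact: ler_normD.
Qed.

Lemma abs_cont_onM a b f g : abs_cont_on a b f -> abs_cont_on a b g ->
  abs_cont_on a b (fun t => f t * g t).
Proof.
move=> acf acg.
have [M M0 HM] := abs_cont_on_bounded _ _ _ acf.
have [K K0 HK] := abs_cont_on_bounded _ _ _ acg.
move=> e e0.
(* The [+ 1] keeps the denominators positive even if a bound is 0. *)
have ef : 0 < e / (2 * (K + 1)) by rewrite divr_gt0//; lra.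
have eg : 0 < e / (2 * (M + 1)) by rewrite divr_gt0//; lra.
have [d1 d10 H1] := acf _ ef; have [d2 d20 H2] := acg _ eg.
exists (Num.min d1 d2); first by rewrite lt_min d10.
move=> n l r lr dis; rewrite lt_min => /andP[s1 s2].
have h1 := H1 n l r lr dis s1; have h2 := H2 n l r lr dis s2.
apply: (@le_lt_trans _ _ (\sum_(i < n) ((K + 1) * `|f (r i) - f (l i)|
    + (M + 1) * `|g (r i) - g (l i)|))).
  apply: ler_sum => i _; have [al lri rb] := lr i.
  rewrite [X in `|X|](_ : _ = (f (r i) - f (l i)) * g (r i)
    + f (l i) * (g (r i) - g (l i))); last by ring.
  rewrite (le_trans (ler_normD _ _))// !normrM [`|_| * `|g (r i)|]mulrC.
  have gK : `|g (r i)| <= K by apply: HK; apply/andP; split; lra.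
  have fM : `|f (l i)| <= M by apply: HM; apply/andP; split; lra.
  by apply: lerD; apply: ler_wpM2r => //; lra.
rewrite big_split/= -!mulr_sumr.
rewrite [ltRHS](_ : _ = (K + 1) * (e / (2 * (K + 1)))
    + (M + 1) * (e / (2 * (M + 1)))); last first.
  by field; apply/andP; split; lra.
by apply: ltrD; rewrite ltr_pM2l//; lra.
Qed.

(** The mean value theorem makes [f] Lipschitz with constant [K]. *)
Lemma bounded_derive_abs_cont a b f (df : R -> R) (K : R) :
  (forall x : R, is_derive x 1 f (df x)) -> (forall x, `|df x| <= K) ->
  abs_cont_on a b f.
Proof.
move=> dfE dfK e e0.
have K0 : 0 <= K by apply: le_trans (dfK 0).
have lip x y : x <= y -> `|f y - f x| <= K * (y - x).
  move=> xy; have [|c _ ->] := @MVT_segment R f df x y xy (fun z _ => dfE z).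
    apply: continuous_subspaceT => z.
    exact/differentiable_continuous/derivable1_diffP/ex_derive.
  by rewrite normrM ler_pM// ger0_norm// subr_ge0.
exists (e / (K + 1)); first by rewrite divr_gt0//; lra.
move=> n l r lr _; rewrite ltr_pdivlMr; last by lra.
apply: le_lt_trans; rewrite mulrDr mulr1 mulr_suml -big_split/= ler_sum// => i _.
have [_ lri _] := lr i; have := lip _ _ lri; lra.
Qed.

Lemma abs_cont_on_cst a b (k : R) : abs_cont_on a b (fun=> k).
Proof.
by apply: (@bounded_derive_abs_cont _ _ _ (fun=> 0) 0) => x; rewrite ?normr0.
Qed.

Lemma is_derive_funD f g (t df dg : R) :
  is_derive t 1 f df -> is_derive t 1 g dg ->
  is_derive t 1 (fun x => f x + g x) (df + dg).
Proof. exact: is_deriveD. Qed.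

Lemma is_derive_funM f g (t df dg : R) :
  is_derive t 1 f df -> is_derive t 1 g dg ->
  is_derive t 1 (fun x => f x * g x) (f t * dg + g t * df).
Proof. exact: is_deriveM. Qed.

Lemma is_derive_affine (k a t : R) : is_derive t 1 (fun x : R => k * (x - a)) k.
Proof.
have h := is_derive_funM _ _ t _ _ (is_derive_cst k t 1)
  (is_derive_funD _ _ t _ _ (is_derive_id t 1) (is_derive_cst (- a) t 1)).
by apply: is_derive_eq h _; rewrite /cst/=; ring.
Qed.

Lemma is_derive_cos_affine (k a t : R) :
  is_derive t 1 (fun x => cos (k * (x - a))) (- (k * sin (k * (t - a)))).
Proof.
have := @is_derive1_comp R cos _ t _ _ (is_derive_cos _) (is_derive_affine k a t).
by move=> h; apply: is_derive_eq h _; rewrite /GRing.scale/=; ring.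
Qed.

Lemma is_derive_sin_affine (k a t : R) :
  is_derive t 1 (fun x => sin (k * (x - a))) (k * cos (k * (t - a))).
Proof.
have := @is_derive1_comp R sin _ t _ _ (is_derive_sin _) (is_derive_affine k a t).
by move=> h; apply: is_derive_eq h _; rewrite /GRing.scale/=; ring.
Qed.

Lemma normr_cos_le1 (x : R) : `|cos x| <= 1.
Proof. by rewrite ler_norml cos_geN1 cos_le1. Qed.

Lemma normr_sin_le1 (x : R) : `|sin x| <= 1.
Proof. by rewrite ler_norml sin_geN1 sin_le1. Qed.

Lemma abs_cont_on_cos (k u a b : R) : abs_cont_on a b (fun t => cos (k * (t - u))).
Proof.
apply: (@bounded_derive_abs_cont _ _ _ _ `|k| (is_derive_cos_affine k u)) => x.
by rewrite normrN normrM ler_piMr// normr_sin_le1.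
Qed.

Lemma abs_cont_on_sin (k u a b : R) : abs_cont_on a b (fun t => sin (k * (t - u))).
Proof.
apply: (@bounded_derive_abs_cont _ _ _ _ `|k| (is_derive_sin_affine k u)) => x.
by rewrite normrM ler_piMr// normr_cos_le1.
Qed.

Lemma lebesgue_aeS (P Q : R -> Prop) : (forall t, P t -> Q t) ->
  {ae @lebesgue_measure R, forall t, P t} -> {ae @lebesgue_measure R, forall t, Q t}.
Proof.
move=> PQ; apply: filterS => //.
exact: (ae_filter_ringOfSetsType (@lebesgue_measure R)).
Qed.

(** In the frame rotating with the flow the coordinates [P] and [Q] have zero derivative almost
    everywhere, hence are constant; rotating back gives the formulas. *)
Lemma rotation_flow (k a b : R) (E U : R -> R) : a <= b ->
  abs_cont_on a b E -> abs_cont_on a b U ->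
  {ae @lebesgue_measure R, forall t, t \in `]a, b[%R ->
    is_derive t 1 E (k * U t) /\ is_derive t 1 U (- (k * E t))} ->
  E b = E a * cos (k * (b - a)) + U a * sin (k * (b - a)) /\
  U b = U a * cos (k * (b - a)) - E a * sin (k * (b - a)).
Proof.
move=> ab acE acU dEU.
have acC := abs_cont_on_cos k a a b; have acS := abs_cont_on_sin k a a b.
pose P t := E t * cos (k * (t - a)) + (-1) * (U t * sin (k * (t - a))).
pose Q t := E t * sin (k * (t - a)) + U t * cos (k * (t - a)).
have PE : P b = P a.
  apply: (@ac_derive0_cst R) => //.
    apply: abs_cont_onD; first exact: abs_cont_onM.
    by apply: abs_cont_onM; [exact: abs_cont_on_cst|exact: abs_cont_onM].
  apply: lebesgue_aeS dEU => t /= H /H[dE dU].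
  have dC := is_derive_cos_affine k a t; have dS := is_derive_sin_affine k a t.
  have h := is_derive_funD _ _ _ _ _ (is_derive_funM _ _ _ _ _ dE dC)
    (is_derive_funM _ _ _ _ _ (is_derive_cst (-1 : R) t 1) (is_derive_funM _ _ _ _ _ dU dS)).
  by apply: is_derive_eq h _; rewrite /cst/=; ring.
have QE : Q b = Q a.
  apply: (@ac_derive0_cst R) => //.
    by apply: abs_cont_onD; exact: abs_cont_onM.
  apply: lebesgue_aeS dEU => t /= H /H[dE dU].
  have dC := is_derive_cos_affine k a t; have dS := is_derive_sin_affine k a t.
  have h := is_derive_funD _ _ _ _ _ (is_derive_funM _ _ _ _ _ dE dS)
    (is_derive_funM _ _ _ _ _ dU dC).
  by apply: is_derive_eq h _; ring.
have Pa : P a = E a by rewrite /P subrr mulr0 cos0 sin0; ring.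
have Qa : Q a = U a by rewrite /Q subrr mulr0 cos0 sin0; ring.
rewrite -Pa -Qa -PE -QE /P /Q.
have := cos2Dsin2 (k * (b - a)); set C := cos _; set S := sin _ => CS.
split.
  by rewrite -[LHS]mulr1 -{1}CS; ring.
by rewrite -[LHS]mulr1 -{1}CS; ring.
Qed.

End ac_algebra.

(** * Adapted coordinates and closed forms along arcs *)

Section arcs.
Variable R : realType.
Implicit Types (g T l r t : R) (x psi p : R -> 'cV[R]_3) (M : R -> 'M[R]_3).

Let i0 : 'I_3 := @Ordinal 3 0 isT.
Let i1 : 'I_3 := @Ordinal 3 1 isT.
Let i2 : 'I_3 := @Ordinal 3 2 isT.

Lemma big_ord3 (F : 'I_3 -> R) : \sum_(i < 3) F i = F i0 + F i1 + F i2.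
Proof.
by rewrite !big_ord_recr big_ord0 /= add0r; congr (F _ + F _ + F _); exact: val_inj.
Qed.

Lemma forall_ord3 (P : 'I_3 -> Prop) : P i0 -> P i1 -> P i2 -> forall i, P i.
Proof.
move=> P0 P1 P2 [[|[|[|//]]] h].
- by rewrite (_ : Ordinal h = i0)//; exact: val_inj.
- by rewrite (_ : Ordinal h = i1)//; exact: val_inj.
- by rewrite (_ : Ordinal h = i2)//; exact: val_inj.
Qed.

Definition ucoord g (v : 'cV[R]_3) : R := sin g * v i1 0 + cos g * v i2 0.
Definition ncoord g (v : 'cV[R]_3) : R := cos g * v i1 0 - sin g * v i2 0.

(** By skew-symmetry the costate obeys the same equation as the state, so [X_arc] serves both. *)
Lemma XmatT g : - (Xmat g)^T = Xmat g.
Proof.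
apply/matrixP => i j; rewrite !mxE.
by elim/forall_ord3: i; elim/forall_ord3: j; rewrite /= ?oppr0 ?opprK.
Qed.

Lemma Xmat_mulE g (v : 'cV[R]_3) :
  [/\ (Xmat g *m v) i0 0 = sin g * ucoord g v,
      (Xmat g *m v) i1 0 = - (sin g ^+ 2 * v i0 0) &
      (Xmat g *m v) i2 0 = - (sin g * cos g * v i0 0)].
Proof. by rewrite !mxE !big_ord3 !mxE /= /ucoord; split; ring. Qed.

Lemma Ymat_mulE (v : 'cV[R]_3) :
  [/\ (Ymat R *m v) i0 0 = v i1 0,
      (Ymat R *m v) i1 0 = - v i0 0 & (Ymat R *m v) i2 0 = 0].
Proof. by rewrite !mxE !big_ord3 !mxE /=; split; ring. Qed.

Lemma e3_ip (v : 'cV[R]_3) : ip (e3 R) v = v i2 0.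
Proof. by rewrite /ip big_ord3 !mxE /=; ring. Qed.

Lemma e3_coord g (v : 'cV[R]_3) : v i2 0 = cos g * ucoord g v - sin g * ncoord g v.
Proof.
by rewrite /ucoord /ncoord -[LHS]mul1r -(cos2Dsin2 g); ring.
Qed.

Lemma ip_F1 g (q v : 'cV[R]_3) :
  ip q (F1 g *m v) = cos g * (ncoord g q * v i0 0 - q i0 0 * ncoord g v).
Proof.
rewrite /ip big_ord3 !mxE !big_ord3 !mxE /= /ncoord.
have -> : sin g ^+ 2 = 1 - cos g ^+ 2 by rewrite sin2cos2.
ring.
Qed.

(** The arc is open, so values of the control at switching times do not matter. *)
Lemma solves_arc T M x l r (A : 'M[R]_3) : solves T M x -> 0 <= l -> r <= T ->
  (forall t, l < t < r -> M t = A) ->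
  (forall i, abs_cont_on l r (fun t => x t i 0)) /\
  {ae @lebesgue_measure R, forall t, t \in `]l, r[%R ->
    forall i, is_derive t 1 (fun u => x u i 0) ((A *m x t) i 0)}.
Proof.
move=> [ac dx] l0 rT MA; split=> [i|]; first exact: abs_cont_onS (ac i).
apply: lebesgue_aeS dx => t /= H; rewrite in_itv/= => /andP[lt_ tr] i.
have [|d dE] := H _ i; first by rewrite in_itv/=; apply/andP; split; lra.
apply: DeriveDef => //; rewrite -derive1E dE MA//.
by rewrite lt_.
Qed.

(** In the orthonormal frame [(e1, u, n)] the equation reads [e1' = s u], [u' = - s e1], [n' = 0]
    for the coordinates. *)
Lemma X_arc g T M x l r : solves T M x -> 0 <= l -> l <= r -> r <= T ->
  (forall t, l < t < r -> M t = Xmat g) ->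
  [/\ x r i0 0 = x l i0 0 * cos (sin g * (r - l))
        + ucoord g (x l) * sin (sin g * (r - l)),
      ucoord g (x r) = ucoord g (x l) * cos (sin g * (r - l))
        - x l i0 0 * sin (sin g * (r - l)) &
      ncoord g (x r) = ncoord g (x l)].
Proof.
move=> sx l0 lr rT MX; have [ac dx] := solves_arc _ _ _ _ _ _ sx l0 rT MX.
have acl (a b : R) : abs_cont_on l r (fun t => a * x t i1 0 + b * x t i2 0).
  by apply: abs_cont_onD; apply: abs_cont_onM => //; exact: abs_cont_on_cst.
have dl (a b t c1 c2 : R) : is_derive t 1 (fun u => x u i1 0) c1 ->
    is_derive t 1 (fun u => x u i2 0) c2 ->
    is_derive t 1 (fun t => a * x t i1 0 + b * x t i2 0) (a * c1 + b * c2).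
  move=> d1 d2; have h := is_derive_funD _ _ _ _ _ _
    (is_derive_funM _ _ _ _ _ _ (is_derive_cst a t 1) d1)
    (is_derive_funM _ _ _ _ _ _ (is_derive_cst b t 1) d2).
  by apply: is_derive_eq h _; rewrite /cst/=; ring.
have [|-> ->] := @rotation_flow R (sin g) l r (fun t => x t i0 0)
    (fun t => ucoord g (x t)) lr (ac i0) (acl _ _).
  apply: lebesgue_aeS dx => t /= /[apply] H; have [e0 e1 e2] := Xmat_mulE g (x t).
  split; first by rewrite -e0.
  apply: is_derive_eq (dl _ _ _ _ _ (H i1) (H i2)) _.
  rewrite e1 e2; have -> : sin g ^+ 2 = 1 - cos g ^+ 2 by rewrite sin2cos2.
  by ring.
split => //.
have nE v : ncoord g v = cos g * v i1 0 + (- sin g) * v i2 0.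
  by rewrite /ncoord mulNr.
rewrite !nE; apply: (@ac_derive0_cst R _ _
  (fun t => cos g * x t i1 0 + (- sin g) * x t i2 0)) => //.
apply: lebesgue_aeS dx => t /= /[apply] H; have [e0 e1 e2] := Xmat_mulE g (x t).
by apply: is_derive_eq (dl _ _ _ _ _ (H i1) (H i2)) _; rewrite e1 e2; ring.
Qed.

Lemma Y_arc T M x l r : solves T M x -> 0 <= l -> l <= r -> r <= T ->
  (forall t, l < t < r -> M t = Ymat R) ->
  [/\ x r i0 0 = x l i0 0 * cos (r - l) + x l i1 0 * sin (r - l),
      x r i1 0 = x l i1 0 * cos (r - l) - x l i0 0 * sin (r - l) &
      x r i2 0 = x l i2 0].
Proof.
move=> sx l0 lr rT MY; have [ac dx] := solves_arc _ _ _ _ _ _ sx l0 rT MY.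
have [|] := @rotation_flow R 1 l r (fun t => x t i0 0)
    (fun t => x t i1 0) lr (ac i0) (ac i1).
  apply: lebesgue_aeS dx => t /= /[apply] H; have [e0 e1 e2] := Ymat_mulE (x t).
  by rewrite !mul1r -e0 -e1.
rewrite !mul1r => -> ->; split => //.
apply: (@ac_derive0_cst R _ _ (fun t => x t i2 0)) => //.
apply: lebesgue_aeS dx => t /= /[apply] H; have [e0 e1 e2] := Ymat_mulE (x t).
by rewrite -e2.
Qed.

(** * The switching function along X-arcs *)

(** The initial state is [u], whose [e1] and [n] coordinates vanish, whatever the costate. *)
Lemma phi1_start g psi p : psi 0 = psi0 g -> phi1 g psi p 0 = 0.
Proof. by move=> E; rewrite /phi1 ip_F1 E /ncoord !mxE /=; ring. Qed.

Lemma phi1_X_arc g T M M' psi p l r : solves T M psi -> solves T M' p ->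
  0 <= l -> l <= r -> r <= T ->
  (forall t, l < t < r -> M t = Xmat g) -> (forall t, l < t < r -> M' t = Xmat g) ->
  phi1 g psi p r = phi1 g psi p l * cos (sin g * (r - l)) +
    cos g * (ncoord g (p l) * ucoord g (psi l) - ucoord g (p l) * ncoord g (psi l))
    * sin (sin g * (r - l)).
Proof.
move=> spsi sp l0 lr rT MX MX'.
have [a1 _ a3] := X_arc _ _ _ _ _ _ spsi l0 lr rT MX.
have [b1 _ b3] := X_arc _ _ _ _ _ _ sp l0 lr rT MX'.
by rewrite /phi1 !ip_F1 a1 a3 b1 b3; ring.
Qed.

(** Starting from a zero, [phi1] is a constant times [sin (s (t - l))]. On an arc shorter than
    [pi / s] a second zero forces the constant to be 0, and the zero at [l] is not isolated. *)
Lemma X_arc_between_zeros g T M M' psi p l r : 0 < sin g ->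
  solves T M psi -> solves T M' p -> 0 <= l -> l < r -> r <= T ->
  (forall t, l < t < r -> M t = Xmat g) -> (forall t, l < t < r -> M' t = Xmat g) ->
  (exists2 e : R, 0 < e & forall u, u \in `[0, T]%R -> 0 < `|u - l| < e ->
     phi1 g psi p u != 0) ->
  phi1 g psi p l = 0 -> phi1 g psi p r = 0 -> pi <= sin g * (r - l).
Proof.
move=> s0 spsi sp l0 lr rT MX MX' [e e0 He] pl pr; rewrite leNgt; apply/negP => srl.
have H t : l <= t <= r -> phi1 g psi p t =
    cos g * (ncoord g (p l) * ucoord g (psi l) - ucoord g (p l) * ncoord g (psi l))
    * sin (sin g * (t - l)).
  move=> /andP[lt_ tr]; rewrite (@phi1_X_arc g T M M' psi p l t)// ?pl ?mul0r ?add0r//.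
  - exact: le_trans rT.
  - by move=> u /andP[lu ut]; apply: MX; rewrite lu (lt_le_trans ut).
  - by move=> u /andP[lu ut]; apply: MX'; rewrite lu (lt_le_trans ut).
have sin0 : sin (sin g * (r - l)) != 0.
  by rewrite gt_eqF// sin_gt0_pi// srl andbT mulr_gt0// subr_gt0.
(* A point of the arc inside the punctured neighbourhood of [l] where [phi1] should not vanish. *)
pose t := Num.min r (l + e / 2).
have lt_ : l < t by rewrite lt_min lr/=; lra.
have tr : t <= r by rewrite ge_min lexx.
have te : t <= l + e / 2 by rewrite ge_min lexx orbT.
have /negP[] : phi1 g psi p t != 0.
  apply: He; first by rewrite in_itv/=; apply/andP; split; lra.
  by rewrite gtr0_norm ?subr_gt0//=; lra.
move: pr; rewrite H ?lexx ?ltW// H ?tr ?ltW// => /eqP.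
by rewrite mulf_eq0 (negbTE sin0) orbF => /eqP ->; rewrite mul0r.
Qed.

(** * The pure X trajectory as competitor *)

(** This is [sin (s t) e1 + cos (s t) u]; writing [t - 0] matches the affine derivative lemmas. *)
Definition X_orbit g t : 'cV[R]_3 := \col_(i < 3)
  match nat_of_ord i with
  | 0%N => sin (sin g * (t - 0))
  | 1%N => sin g * cos (sin g * (t - 0))
  | _ => cos g * cos (sin g * (t - 0))
  end.

Lemma X_orbit_trajectory g T : 0 <= T -> trajectory g T [::] [:: true] (X_orbit g).
Proof.
move=> T0; have X0 t : X_orbit g t i0 0 = sin (sin g * (t - 0)) by rewrite mxE.
have X1 t : X_orbit g t i1 0 = sin g * cos (sin g * (t - 0)) by rewrite mxE.
have X2 t : X_orbit g t i2 0 = cos g * cos (sin g * (t - 0)) by rewrite mxE.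
split; first by split.
split; last first.
  apply/matrixP => i j; rewrite !mxE; elim/forall_ord3: i => /=;
    by rewrite subrr mulr0 ?sin0 ?cos0 ?mulr1.
have acc (a : R) : abs_cont_on 0 T (fun t => a * cos (sin g * (t - 0))).
  by apply: abs_cont_onM; [exact: abs_cont_on_cst|exact: abs_cont_on_cos].
split.
  elim/forall_ord3.
  - by under eq_fun do rewrite X0; exact: abs_cont_on_sin.
  - by under eq_fun do rewrite X1; exact: acc.
  - by under eq_fun do rewrite X2; exact: acc.
apply: aeW => t _.
have dcos (a : R) := is_derive_funM _ _ _ _ _ _ (is_derive_cst a t 1)
  (is_derive_cos_affine _ (sin g) 0 t).
suff H i : is_derive t 1 (fun u => X_orbit g u i 0) ((Xmat g *m X_orbit g t) i 0).
  by move=> i; have [d dE] := H i; split => //; rewrite derive1E dE.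
have [e0 e1 e2] := Xmat_mulE g (X_orbit g t).
elim/forall_ord3: i.
- under eq_fun do rewrite X0.
  apply: is_derive_eq (is_derive_sin_affine _ (sin g) 0 t) _.
  rewrite e0 /ucoord X1 X2.
  rewrite -[in LHS](mulr1 (cos (sin g * _))) -(cos2Dsin2 g); ring.
- under eq_fun do rewrite X1.
  by apply: is_derive_eq (dcos (sin g)) _; rewrite e1 X0 /cst/=; ring.
- under eq_fun do rewrite X2.
  by apply: is_derive_eq (dcos (cos g)) _; rewrite e2 X0 /cst/=; ring.
Qed.

Lemma X_orbit_inSigma g : sin g != 0 -> inSigma (X_orbit g (pi / 2 / sin g)).
Proof.
by move=> s0; rewrite /inSigma e3_ip mxE /= subr0 (mulrC (sin g))
  mulrVK ?unitfE// cos_pihalf mulr0.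
Qed.

Lemma time_optimal_le g T : 0 < sin g -> time_optimal g T -> sin g * T <= pi / 2.
Proof.
move=> s0 /(_ _ _ _ _ (X_orbit_trajectory g (pi / 2 / sin g) _)) H.
rewrite mulrC -ler_pdivlMr//; apply: H; last by apply: X_orbit_inSigma; rewrite gt_eqF.
by rewrite !divr_ge0// ?pi_ge0// ltW.
Qed.

(** * Height along the pattern YX *)

(* The right-hand side is the height [e3 / c] at time [S] after a Y-arc of
   length [x] followed by an X-arc; it is increasing in [x], and the left-hand
   side is its value at [x = 0]. *)
Lemma YX_height_gt (s c S x : R) : 0 < s -> s ^+ 2 + c ^+ 2 = 1 ->
  0 < x <= pi -> x <= S -> s * S <= pi / 2 ->
  cos (s * S) < (s ^+ 2 * cos x + c ^+ 2) * cos (s * (S - x))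
     - s * sin x * sin (s * (S - x)) + s ^+ 2 * (1 - cos x).
Proof.
move=> s0 sc /andP[x0 xpi] xS sS.
pose f y := (s ^+ 2 * cos (1 * (y - 0)) + c ^+ 2) * cos ((- s) * (y - S))
     + (s * sin (1 * (y - 0))) * sin ((- s) * (y - S)) * (-1)
     + s ^+ 2 * (1 + (-1) * cos (1 * (y - 0))).
pose df y := s * (c ^+ 2 * sin (s * (S - y)) * (1 - cos y) + s * sin y).
have dfE (y : R) : is_derive y 1 f (df y).
  have dC := is_derive_cos_affine _ 1 0 y; have dS := is_derive_sin_affine _ 1 0 y.
  have dC' := is_derive_cos_affine _ (- s) S y.
  have dS' := is_derive_sin_affine _ (- s) S y.
  have cs (k : R) := is_derive_cst k y (1 : R).
  have D := is_derive_funD R; have M := is_derive_funM R.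
  have h := D _ _ _ _ _ (D _ _ _ _ _
     (M _ _ _ _ _ (D _ _ _ _ _ (M _ _ _ _ _ (cs (s ^+ 2)) dC) (cs (c ^+ 2))) dC')
     (M _ _ _ _ _ (M _ _ _ _ _ (M _ _ _ _ _ (cs s) dS) dS') (cs (-1))))
     (M _ _ _ _ _ (cs (s ^+ 2)) (D _ _ _ _ _ (cs 1) (M _ _ _ _ _ (cs (-1)) dC))).
  apply: is_derive_eq h _; rewrite /cst/= /df subr0 !mul1r.
  have -> : - s * (y - S) = s * (S - y) by ring.
  have -> : c ^+ 2 = 1 - s ^+ 2 by rewrite -sc; ring.
  ring.
have [|y] := @MVT R f df 0 x x0 (fun z _ => dfE z).
  apply: continuous_subspaceT => z.
  exact/differentiable_continuous/derivable1_diffP/ex_derive.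
rewrite in_itv/= => /andP[y0 yx] fE.
have siny : 0 < sin y by rewrite sin_gt0_pi// y0/=; lra.
(* Since [y < x <= S], the angle [s * (S - y)] lies in [[0, pi]]; the first summand of [df] is then
   nonnegative and the second positive. *)
have sSy : 0 <= sin (s * (S - y)).
  apply: sin_ge0_pi; apply/andP; split; first by rewrite mulr_ge0//; lra.
  have : 0 < s * y by rewrite mulr_gt0.
  have := pi_ge0 R; lra.
have df0 : 0 < df y.
  rewrite /df mulr_gt0// ltr_wpDl//; last by rewrite mulr_gt0.
  by rewrite mulr_ge0// ?subr_ge0 ?cos_le1// mulr_ge0// sqr_ge0.
have : 0 < f x - f 0 by rewrite fE mulr_gt0// subr0.
rewrite /f !subr0 !mul1r sin0 cos0 subr_gt0.
have -> : - s * (x - S) = s * (S - x) by ring.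
have -> : - s * (0 - S) = s * S by ring.
rewrite mulr1 sc; lra.
Qed.

Lemma YX_height_pos (s c tau t : R) : 0 < s -> s ^+ 2 + c ^+ 2 = 1 ->
  0 < tau -> 0 <= t -> s * (tau + t) <= pi / 2 ->
  0 < (s ^+ 2 * cos tau + c ^+ 2) * cos (s * t)
     - s * sin tau * sin (s * t) + s ^+ 2 * (1 - cos tau).
Proof.
move=> s0 sc tau0 t0 sS.
have stau : 0 < s * tau by rewrite mulr_gt0.
have st0 : 0 <= s * t by rewrite mulr_ge0// ltW.
(* The strict bound covers [x = 0], where the height is only [cos (s * t)]. After reflection it
   comes from [acos (cos tau) <= pi < tau]. *)
have key (x : R) : 0 <= x <= pi -> s * (x + t) < pi / 2 ->
     0 < (s ^+ 2 * cos x + c ^+ 2) * cos (s * t)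
     - s * sin x * sin (s * t) + s ^+ 2 * (1 - cos x).
  move=> /andP[x0 xpi] sx.
  have sx0 : 0 <= s * x by rewrite mulr_ge0// ltW.
  have cpos : 0 < cos (s * (x + t)).
    by apply: cos_gt0_pihalf; rewrite sx andbT; have := pi_gt0 R; lra.
  have [xE|xn0] := eqVneq x 0.
    move: cpos; rewrite xE add0r cos0 sin0 mulr1 sc; lra.
  have := @YX_height_gt s c (x + t) x s0 sc _ _ (ltW sx).
  rewrite lt_neqAle eq_sym xn0 x0 xpi lerDl => /(_ isT t0).
  rewrite (_ : x + t - x = t); last by ring.
  exact: lt_trans.
have [taupi|pitau] := leP tau pi.
  have := @YX_height_gt s c (tau + t) tau s0 sc _ _ sS.
  rewrite tau0 taupi lerDl => /(_ isT t0); rewrite (_ : tau + t - tau = t); last by ring.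
  apply: le_lt_trans; apply: cos_ge0_pihalf; rewrite sS andbT.
  by have := pi_gt0 R; lra.
(* Reflecting the Y-arc across the symmetry plane only lowers the height. *)
have cb : -1 <= cos tau <= 1 by rewrite cos_geN1 cos_le1.
have [acb acE] := acos_def cb.
have := key (acos (cos tau)) acb; rewrite acE => H.
have {}H := H _.
have spi : s * pi < s * tau by rewrite ltr_pM2l.
have sac : s * acos (cos tau) <= s * pi by rewrite ler_pM2l//; case/andP: acb.
apply: lt_le_trans (H _) _; first lra.
rewrite lerD2r lerD2l lerN2 ler_wpM2r//.
  apply: sin_ge0_pi; rewrite st0/=; lra.
rewrite ler_pM2l// sin_acos// -sin2cos2 sqrtr_sqr; exact: ler_norm.
Qed.

(** * Reading off the control, and exclusion of patterns *)

(** [label] counts switching times strictly before [t], so [t1] itself still belongs to the first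
    arc. *)
Lemma ctrl_fst g t1 ts bs t : path <%R 0 (t1 :: ts) -> t <= t1 ->
  ctrl g (t1 :: ts) bs t = if nth false bs 0 then Xmat g else Ymat R.
Proof.
move=> /andP[_ /(order_path_min lt_trans)/allP ht] tt1.
rewrite /ctrl /label (_ : count _ _ = 0%N)//=; rewrite ltNge tt1 add0n.
apply/eqP; rewrite -leqn0 leqNgt -has_count; apply/hasPn => u /ht t1u.
by rewrite -leNgt (le_trans tt1)// ltW.
Qed.

Lemma ctrl_snd g t1 t2 ts bs t : path <%R 0 (t1 :: t2 :: ts) -> t1 < t <= t2 ->
  ctrl g (t1 :: t2 :: ts) bs t = if nth false bs 1 then Xmat g else Ymat R.
Proof.
move=> /and3P[_ _ /(order_path_min lt_trans)/allP ht] /andP[t1t tt2].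
rewrite /ctrl /label (_ : count _ _ = 1%N)//=; rewrite t1t ltNge tt2 add0n.
rewrite (_ : count _ ts = 0%N)//.
apply/eqP; rewrite -leqn0 leqNgt -has_count; apply/hasPn => u /ht t2u.
by rewrite -leNgt (le_trans tt2)// ltW.
Qed.

Lemma YX_not_inSigma g T tau psi : 0 < sin g -> 0 < cos g -> sin g * T <= pi / 2 ->
  trajectory g T [:: tau] [:: false; true] psi -> inSigma (psi T) -> False.
Proof.
move=> s0 c0 sT [[T0 _ tau0 tauT] [spsi psi00]].
move: tau0 tauT; rewrite /= !andbT => tau0 tauT.
have tau_path : path <%R 0 [:: tau] by rewrite /= tau0.
have [|y1 y2 y3] := @Y_arc T _ psi 0 tau spsi (lexx _) (ltW tau0) (ltW tauT).
  by move=> t /andP[_ ttau]; rewrite (ctrl_fst _ _ _ _ _ tau_path (ltW ttau)).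
have [|_ xu xn] := @X_arc g T _ psi tau T spsi (ltW tau0) (ltW tauT) (lexx _).
  by move=> t /andP[taut _]; rewrite /ctrl /label /= taut.
rewrite /inSigma e3_ip (e3_coord g) xu xn /ucoord /ncoord y1 y2 y3 psi00 !mxE /= subr0.
have /(_ s0) H := @YX_height_pos (sin g) (cos g) tau (T - tau).
have := H _ tau0 _ _; rewrite subrKC addrC cos2Dsin2 subr_ge0.
move=> /(_ erefl (ltW tauT) sT) h e.
have : 0 < cos g * ((sin g ^+ 2 * cos tau + cos g ^+ 2) * cos (sin g * (T - tau))
  - sin g * sin tau * sin (sin g * (T - tau)) + sin g ^+ 2 * (1 - cos tau)).
  exact: mulr_gt0.
rewrite -[X in _ < X]subr0 -[X in _ - X]e; apply/negP; rewrite -leNgt le_eqVlt.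
by apply/orP; left; apply/eqP; ring.
Qed.

End arcs.

Theorem mainTheorem13 (R : realType) (g T : R) (ts : seq R) (bs : seq bool)
    (psi p : R -> 'cV[R]_3) :
  0 < g < pi / 2 ->
  normal_extremal g T ts bs psi p ->
  regular g T ts psi p ->
  time_optimal g T ->
  (size ts <= 2)%N /\ (bs = [:: true] \/ bs = [:: true; false; true]).
Proof.
move=> g0 [[traj alt] sig sp _ _] [isol sw] opt.
have s0 : 0 < sin g by exact: sin_gt0_pihalf.
have c0 : 0 < cos g.
  by apply: cos_gt0_pihalf; case/andP: g0 => g0 ->; rewrite andbT; have := pi_gt0 R; lra.
have sT := time_optimal_le _ _ _ s0 opt.
have pi0 := pi_gt0 R.
have [[T0 szbs pth allT] [spsi psi00]] := traj.
(* Such an arc would last at least [pi / s], while optimality gives [T <= pi / (2 s)]. *)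
have no_X_arc l r : 0 <= l -> l < r -> r <= T ->
    (forall t, l < t < r -> ctrl g ts bs t = Xmat g) ->
    phi1 g psi p l = 0 -> phi1 g psi p r = 0 -> False.
  move=> l0 lr rT MX pl pr.
  have : pi <= sin g * (r - l).
    apply: (@X_arc_between_zeros R g T _ _ psi p l r s0 spsi sp l0 lr rT MX) => //.
      by move=> t /MX ->; exact: XmatT.
    by apply: isol => //; rewrite in_itv/= l0/=; lra.
  have : sin g * (r - l) <= sin g * T by rewrite ler_pM2l//; lra.
  by lra.
case: bs szbs alt traj sp spsi no_X_arc => // b0 bs [szbs] alt traj sp spsi no_X_arc.
case: ts szbs pth allT sw traj sp spsi no_X_arc => [|t1 ts].
  (* No switching: a single Y-arc keeps the height at [c > 0], so the arc is X. Every pattern with a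
     switching is refuted below, so [[:: true]] is the disjunct established. *)
  case: bs alt => // alt _ _ _ _ _ _ spsi _; split => //; left.
  case: b0 spsi alt => // spsi _.
  have [//|_ _ e] := @Y_arc R T _ psi 0 T spsi (lexx _) T0 (lexx _).
  by move: sig; rewrite /inSigma e3_ip e psi00 mxE /= => c00; move: c0; rewrite c00 ltxx.
case: bs alt => // b1 bs alt [szbs] pth allT sw traj sp spsi no_X_arc.
have /andP[t10 pth1] := pth; have /andP[t1T allT1] := allT.
have [p1 _] := sw t1 (mem_head _ _).
(* A first X-arc would run between the zeros of [phi1] at 0 and [t1]. *)
case: b0 alt traj sp spsi no_X_arc => alt traj sp spsi no_X_arc.
  exfalso; apply: (no_X_arc 0 t1) => //; first exact: ltW.
    by move=> t /andP[_ tt1]; rewrite (ctrl_fst _ _ _ _ _ _ pth (ltW tt1)).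
  exact: phi1_start.
(* The first arc is now Y, so alternation makes the second X. *)
have b1t : b1 = true by have := alt 0%N isT; case: (b1).
rewrite {}b1t in alt traj sp spsi no_X_arc *.
case: ts szbs pth allT sw pth1 allT1 traj sp spsi no_X_arc => [|t2 ts].
  case: bs alt => // *; exfalso.
  by apply: (@YX_not_inSigma R g T t1 psi).
(* With a second switching, the X-arc from [t1] to [t2] joins two zeros of [phi1]. *)
move=> szbs pth allT sw pth1 allT1 traj sp spsi no_X_arc; exfalso.
have /andP[t12 _] := pth1; have /andP[t2T _] := allT1.
have [|p2 _] := sw t2; first by rewrite !inE eqxx orbT.
apply: (no_X_arc t1 t2) => //; [exact: ltW|exact: ltW|].
by move=> t /andP[t1t tt2]; rewrite (ctrl_snd _ _ _ _ _ _ _ pth) ?t1t ?ltW.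
Qed.
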